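(* Let $p>1$, let $T>0$ and let $H\in\mathscr H$ (in dimension one). The level $\lambda_p^H(-T,T)$ is positive if and only if $H\ne0$.
   Context: $\mathscr H$ is the set of functions $H:\mathbb R\to\mathbb R$ that are non-negative, convex and positively $1$-homogeneous ($H(tx)=tH(x)$ for $t>0$). For $H\in\mathscr H$, $$\lambda_p^H(-T,T):=\inf\Big\{\int_{-T}^T H(u'(t))^p\,dt:\ u\in W_0^{1,p}(-T,T),\ \int_{-T}^T|u|^p\,dt=1\Big\}.$$ *)

(* Defs.v *)
From HB Require Import structures.
From mathcomp Require Import all_boot all_order all_algebra.
From mathcomp Require Import all_classical all_reals all_analysis.

Set Implicit Arguments.
Unset Strict Implicit.
Unset Printing Implicit Defensive.

Import Order.TTheory GRing.Theory Num.Theory.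
Import numFieldNormedType.Exports.

Local Open Scope classical_set_scope.
Local Open Scope ring_scope.

Definition scrH (R : realType) : set (R -> R) :=
  [set H : R -> R |
    [/\ forall x, 0 <= H x,
        convex_function (setT : set R^o) H
      & forall t x : R, 0 < t -> H (t * x) = t * H x]].

(* Elements of function spaces over an open set [D] of the line are represented
   by total functions [R -> R], of which only the values on [D] matter;
   [f \_ D] is the extension by zero of the restriction of [f] to [D]. *)

Definition Lp (R : realType) (D : set R) (p : R) : set (R -> R) :=
  [set f | f \_ D \in Lfun (@lebesgue_measure R) p%:E].

Definition Lp_norm (R : realType) (D : set R) (p : R) (f : R -> R) : \bar R :=
  'N[@lebesgue_measure R]_(p%:E)[EFin \o f \_ D]%E.

(* C_c^oo(D) *)
Definition test_function (R : realType) (D : set R) : set (R -> R) :=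
  [set phi : R -> R |
    [/\ forall (n : nat) (x : R), derivable (phi^`(n)%classic) x 1,
        compact (closure [set x | phi x != 0])
      & closure [set x | phi x != 0] `<=` D]].

Definition weak_derivative (R : realType) (D : set R) (u v : R -> R) : Prop :=
  forall phi, test_function D phi ->
    \int[@lebesgue_measure R]_(x in D) (u x * (phi^`()%classic) x) =
    - \int[@lebesgue_measure R]_(x in D) (v x * phi x).

(* [W1p D p (u, v)]: u is in W^{1,p}(D) and u' = v. As the weak derivative is
   only determined almost everywhere, it is carried along with u. *)
Definition W1p (R : realType) (D : set R) (p : R) : set ((R -> R) * (R -> R)) :=
  [set uv | [/\ Lp D p uv.1, Lp D p uv.2 & weak_derivative D uv.1 uv.2]].

Definition W1p_norm (R : realType) (D : set R) (p : R)
    (uv : (R -> R) * (R -> R)) : \bar R :=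
  (Lp_norm D p uv.1 + Lp_norm D p uv.2)%E.

(* The closure of C_c^oo(D) in W^{1,p}(D) *)
Definition W01p (R : realType) (D : set R) (p : R) :
    set ((R -> R) * (R -> R)) :=
  [set uv | W1p D p uv /\
     forall e : R, 0 < e -> exists2 phi, test_function D phi &
       (W1p_norm D p ((uv.1 \- phi)%R, (uv.2 \- phi^`()%classic)%R) < e%:E)%E].

Definition lambda (R : realType) (H : R -> R) (p T : R) : \bar R :=
  let mu := @lebesgue_measure R in
  let D := `](- T), T[%classic in
  ereal_inf [set E | exists u v : R -> R,
    [/\ W01p D p (u, v),
        (\int[mu]_(t in D) (`|u t| `^ p)%:E = 1)%E
      & E = (\int[mu]_(t in D) (H (v t) `^ p)%:E)%E]].

(* Main.v *)
Require Import Defs.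
From mathcomp Require Import all_boot all_order all_algebra.
From mathcomp Require Import all_classical all_reals all_analysis.
From mathcomp Require Import measurable_realfun.
From mathcomp Require Import ring lra.

(** A positively homogeneous [H >= 0] on the line satisfies [H x >= max (c x) 0]
    with [c = H 1] or [c = - H (-1)], and [c] can be chosen nonzero unless
    [H = 0]. A test function [phi] on [(a, b)] vanishes at both ends, so that
    [c phi(x)] is the integral of [c phi'] over [(a, x)] and [- c phi(x)] is the
    integral of [c phi'] over [(x, b)]; hence the positive part of [c phi'] alone
    bounds [|c phi|], and by Hoelder's inequality
    [|c| ||phi||_p <= (b - a) ||max (c phi') 0||_p]. By density this one-sided
    Poincare inequality holds on [W_0^{1,p}], which bounds the level below by
    [(|c| / (2 T))^p]. If [H = 0], the level is [0] as soon as the set of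
    admissible functions is nonempty, that is, as soon as there is a nonzero test
    function; it is built from [exp (-1/x)]. *)

Set Implicit Arguments.
Unset Strict Implicit.
Unset Printing Implicit Defensive.

Import Order.TTheory GRing.Theory Num.Theory.
Import numFieldNormedType.Exports.

Local Open Scope classical_set_scope.
Local Open Scope ring_scope.

(** * The L^p seminorm on a bounded interval *)

Section Lp_norm_theory.
Variables (R : realType) (a b p : R).
Hypotheses (ab : a < b) (p1 : 1 < p).
Local Notation mu := (@lebesgue_measure R).
Let D : set R := `]a, b[.
Let p0 : 0 < p. Proof. exact: lt_trans p1. Qed.
Let mD : measurable D. Proof. exact: measurable_itv. Qed.

Let muD : mu D = (b - a)%:E.
Proof. by rewrite /D lebesgue_measure_itv/= lte_fin ab. Qed.

Lemma measurable_fun_normr_powR (f : R -> R) : measurable_fun D f ->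
  measurable_fun D (EFin \o (fun x => `|f x| `^ p)).
Proof.
move=> mf; apply/measurable_EFinP.
apply: (measurableT_comp (measurable_powR _)).
exact: measurableT_comp.
Qed.

Lemma Lp_normE (f : R -> R) :
  Lp_norm D p f = ((\int[mu]_(x in D) (`|f x| `^ p)%:E) `^ p^-1)%E.
Proof.
rewrite /Lp_norm unlock [in RHS]integral_mkcond; congr (_ `^ _)%E.
apply: eq_integral => x _; rewrite /patch /=; case: ifPn => // _.
(* Off [D] the integrand is 0 to the power [p], which is 0 because [p] is nonzero. *)
by rewrite normr0 powR0// gt_eqF.
Qed.

Lemma Lp_norm_powR (f : R -> R) :
  (Lp_norm D p f `^ p = \int[mu]_(x in D) (`|f x| `^ p)%:E)%E.
Proof.
rewrite Lp_normE -poweRrM mulVf ?gt_eqF// poweRe1//.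
by apply: integral_ge0 => x _; rewrite lee_fin powR_ge0.
Qed.

Lemma le_Lp_norm (f g : R -> R) : measurable_fun D f -> measurable_fun D g ->
  (forall x, D x -> `|f x| <= `|g x|) -> (Lp_norm D p f <= Lp_norm D p g)%E.
Proof.
move=> mf mg fg; rewrite !Lp_normE.
have ge0 h : (0 <= \int[mu]_(x in D) (`|h x| `^ p)%:E)%E.
  by apply: integral_ge0 => x _; rewrite lee_fin powR_ge0.
apply: gt0_ler_poweR; rewrite ?invr_ge0 ?(ltW p0) ?in_itv/= ?ge0 ?leey//.
apply: ge0_le_integral => //.
- exact: measurable_fun_normr_powR.
- exact: measurable_fun_normr_powR.
- by move=> x Dx; rewrite lee_fin ge0_ler_powR ?nnegrE ?(ltW p0)//; exact: fg.
Qed.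

Lemma Lp_normZ (f : R -> R) (c : R) : measurable_fun D f ->
  (Lp_norm D p (fun x => c * f x)%R = `|c|%:E * Lp_norm D p f)%E.
Proof.
move=> mf; rewrite !Lp_normE.
under eq_integral do rewrite normrM powRM// EFinM.
rewrite ge0_integralZl_EFin ?powR_ge0//; last exact: measurable_fun_normr_powR.
rewrite poweRM ?lee_fin ?powR_ge0//; last first.
  by apply: integral_ge0 => x _; rewrite lee_fin powR_ge0.
by rewrite poweR_EFin -powRrM mulfV ?gt_eqF// powRr1.
Qed.

Lemma Lp_normD (f g : R -> R) : measurable_fun D f -> measurable_fun D g ->
  (Lp_norm D p (f \+ g)%R <= Lp_norm D p f + Lp_norm D p g)%E.
Proof.
move=> mf mg; rewrite /Lp_norm.
have -> : (f \+ g) \_ D = (f \_ D \+ g \_ D)%R.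
  by apply/funext => x /=; rewrite /patch; case: ifPn; rewrite ?addr0.
by apply: minkowski_EFin; rewrite ?ltW//; apply/(measurable_restrictT _ _).1.
Qed.

Lemma Lp_norm_ge0 (f : R -> R) : (0 <= Lp_norm D p f)%E.
Proof. exact: Lnorm_ge0. Qed.

Lemma Lp_norm_le_cst (f : R -> R) (M : R) : measurable_fun D f ->
  (forall x, D x -> `|f x| <= M) ->
  (Lp_norm D p f <= M%:E * ((b - a) `^ p^-1)%:E)%E.
Proof.
move=> mf fM.
(* [D] is nonempty: the bound at its midpoint already forces the sign of [M]. *)
have M0 : 0 <= M.
  by apply: le_trans (fM ((a + b) / 2) _) => //=; rewrite /D/= in_itv/= !midf_lt.
apply: (@le_trans _ _ (Lp_norm D p (cst M))).
  by apply: le_Lp_norm => // x /fM; rewrite (ger0_norm M0).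
rewrite Lp_normE; under eq_integral do rewrite /= (ger0_norm M0).
rewrite integral_cst//.
rewrite [X in (_ * X)%E]muD -EFinM poweR_EFin powRM ?powR_ge0 ?subr_ge0 ?(ltW ab)//.
by rewrite -powRrM mulfV ?gt_eqF// powRr1// EFinM.
Qed.

(* Hoelder's inequality against the indicator function of the interval. *)
Lemma integral_le_Lp_norm (f : R -> R) : measurable_fun D f ->
  (\int[mu]_(x in D) `|f x|%:E <=
   Lp_norm D p f * ((b - a) `^ (1 - p^-1))%:E)%E.
Proof.
(* [q] is the conjugate exponent of [p], so the indicator of [D] has L^q norm (b - a)^(1/q), with
   1/q = 1 - 1/p. *)
move=> mf; pose q := (1 - p^-1)^-1.
have q0 : 0 < q by rewrite invr_gt0 subr_gt0 invf_lt1.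
have := @hoelder _ _ R mu (f \_ D) (\1_D) p q _ _ p0 q0 _.
have -> : 'N[mu]_1[EFin \o (f \_ D \* \1_D)%R]%E = (\int[mu]_(x in D) `|f x|%:E)%E.
  rewrite Lnorm1 [RHS]integral_mkcond; apply: eq_integral => x _ /=.
  by rewrite /patch indicE; case: ifPn => xD; rewrite ?mulr1// mul0r normr0.
have -> : 'N[mu]_q%:E[EFin \o \1_D]%E = ((b - a) `^ (1 - p^-1))%:E.
  rewrite unlock/= -[(1 - p^-1)%R]invrK -/q -poweR_EFin -muD.
  congr (_ `^ _)%E; transitivity (\int[mu]_x (\1_D x)%:E)%E.
    apply: eq_integral => x _ /=; rewrite indicE.
    by case: (x \in D); rewrite /= ?normr1 ?powR1 ?normr0 ?powR0 ?gt_eqF.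
  by rewrite integral_indic// setIT.
apply.
- exact/(measurable_restrictT _ _).1.
- exact: measurable_indic.
- by rewrite /q invrK addrC subrK.
Qed.

End Lp_norm_theory.

(** * Test functions on an interval *)

Section test_function_theory.
Variables (R : realType) (a b : R).
Hypothesis ab : a < b.
Local Notation mu := (@lebesgue_measure R).
Let D : set R := `]a, b[.
Implicit Types phi : R -> R.

Lemma test_function_derivable phi (x : R) : test_function D phi ->
  derivable phi x 1.
Proof. by move=> [+ _ _] => /(_ 0%N x). Qed.

Lemma test_function_continuous phi : test_function D phi -> continuous phi.
Proof.
move=> tphi x; apply/differentiable_continuous/derivable1_diffP.
exact: test_function_derivable.
Qed.

Lemma test_function_derive_continuous phi : test_function D phi ->
  continuous (phi^`())%classic.
Proof.
move=> [dphi _ _] x; apply/differentiable_continuous/derivable1_diffP.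
by have := dphi 1%N x; rewrite derive1n1.
Qed.

Lemma test_function_eq0 phi x : test_function D phi -> ~ D x -> phi x = 0.
Proof.
move=> [_ _ suppD] nDx; apply/eqP/negPn/negP => phix.
by apply/nDx/suppD/subset_closure.
Qed.

Lemma derive1nZ (c : R) (f : R -> R) n :
  (forall (k : nat) (x : R), derivable (f^`(k)%classic) x 1) ->
  (fun x => c * f x)^`(n)%classic = (fun x => c * (f^`(n))%classic x).
Proof.
move=> df; elim: n => [|n ih]; first by rewrite !derive1n0.
rewrite !derive1nS ih; apply/funext => x.
rewrite derive1Ml//; exact: df.
Qed.

(** Serves twice: a factor of either sign selects which half of the derivative is kept in the
    Poincare inequality, and a positive factor normalizes a bump. *)
Lemma test_functionZ (c : R) phi : test_function D phi ->
  test_function D (fun x => c * phi x).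
Proof.
(* Only an inclusion of supports, since [c] may be 0; a closed subset of a compact set is
   compact. *)
move=> [dphi cphi sphi]; have sub : closure [set x | c * phi x != 0] `<=`
    closure [set x | phi x != 0].
  apply: closure_subset => x /=; apply: contra_neq => ->; exact: mulr0.
split.
- move=> n x; rewrite derive1nZ//.
  exact: (@derivableM _ _ (cst c) (phi^`(n)%classic)).
- by apply: subclosed_compact cphi sub; exact: closed_closure.
- exact: subset_trans sub sphi.
Qed.

Lemma test_functionZ_derive (c : R) phi : test_function D phi ->
  (fun x => c * phi x)^`()%classic = (fun x => c * (phi^`())%classic x).
Proof. by move=> [dphi _ _]; have := derive1nZ c 1 dphi; rewrite !derive1n1. Qed.

Lemma derivable_oo_LRcontinuousT (f : R -> R) (x y : R) :
  (forall z, derivable f z 1) -> derivable_oo_LRcontinuous f x y.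
Proof.
move=> df; have cf : continuous f.
  by move=> z; exact/differentiable_continuous/derivable1_diffP.
by split=> //; [apply: cvg_at_right_filter|apply: cvg_at_left_filter];
  exact: cf.
Qed.

(* Both [phi x] and [- phi x] are integrals of [phi'], over [[a, x]] and
   [[x, b]] respectively: this is why the positive part of [phi'] alone
   controls [phi]. *)
Lemma test_function_le_integral phi x : test_function D phi -> D x ->
  (`|phi x|%:E <= \int[mu]_(t in D) (Num.max (phi^`()%classic t) 0)%:E)%E.
Proof.
move=> tphi Dx; set g := fun t => Num.max (phi^`()%classic t) 0.
have cphi' := test_function_derive_continuous tphi.
have cg : continuous g.
  by move=> t; apply: continuous_max; [exact: cphi'|exact: cst_continuous].
have mg A : measurable_fun A (EFin \o g).
  apply/measurable_EFinP; apply: measurable_funTS.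
  exact: continuous_measurable_fun.
have g0 t : 0 <= g t by rewrite /g le_max lexx orbT.
(* An increment of [phi] is the integral of its derivative, which is at most [g]; as [g] is
   non-negative, the domain may then grow to all of [D]. *)
have FTC y z : a <= y -> y < z -> z <= b ->
    ((phi z - phi y)%:E <= \int[mu]_(t in D) (g t)%:E)%E.
  move=> ay yz zb.
  rewrite EFinB -(continuous_FTC2 (f := phi^`()%classic))//; last 2 first.
  - exact: continuous_subspaceT.
  - apply: derivable_oo_LRcontinuousT => t.
    exact: test_function_derivable tphi.
  apply: (@le_trans _ _ (\int[mu]_(t in `[y, z]) (g t)%:E)%E).
    apply: le_integral => //=.
    - apply: continuous_compact_integrable; first exact: segment_compact.
      exact: continuous_subspaceT.
    - apply: continuous_compact_integrable; first exact: segment_compact.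
      exact: continuous_subspaceT.
    - by move=> t _; rewrite lee_fin /g le_max lexx.
  (* Endpoints are null; without them the interval lies in [D] even if [y] is [a] or [z] is [b]. *)
  rewrite -(integral_itv_bndo_bndc (mg _)) -(integral_itv_obnd_cbnd (mg _)).
  apply: ge0_subset_integral => //=.
  - exact: measurable_itv.
  - exact: mg.
  - by move=> t _; rewrite lee_fin.
  move=> t /=; rewrite /D/= !in_itv/= => /andP[yt tz].
  by rewrite (le_lt_trans ay yt) (lt_le_trans tz zb).
have phia : phi a = 0.
  by apply: test_function_eq0 tphi _; rewrite /D/= in_itv/= ltxx.
have phib : phi b = 0.
  by apply: test_function_eq0 tphi _; rewrite /D/= in_itv/= ltxx andbF.
move: Dx; rewrite /D/= in_itv/= => /andP[ax xb].
have := FTC a x (lexx _) ax (ltW xb); rewrite phia subr0 => le1.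
have := FTC x b (ltW ax) xb (lexx _); rewrite phib sub0r => le2.
by case: (ger0P (phi x)).
Qed.

(** Integration by parts, whose boundary terms vanish because [phi] is 0 at [a] and [b]. *)
Lemma weak_derivative_test_function phi : test_function D phi ->
  weak_derivative D phi (phi^`()%classic).
Proof.
move=> tphi psi tpsi.
have cphi := test_function_continuous tphi.
have cpsi := test_function_continuous tpsi.
have cphi' := test_function_derive_continuous tphi.
have cpsi' := test_function_derive_continuous tpsi.
(* Integration by parts is available on closed intervals; the endpoints do not change the
   integral. *)
have toitv (f : R -> R) : continuous f ->
    \int[mu]_(x in D) f x = \int[mu]_(x in `[a, b]) f x.
  move=> cf; have intf (A : set R) : measurable A -> A `<=` `[a, b] ->
      mu.-integrable A (EFin \o f).
    move=> mA Aab.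
    apply: (@integrableS _ (measurableTypeR R) R mu `[a, b]%classic A
      (EFin \o f) _ mA Aab) => //.
    apply: continuous_compact_integrable; first exact: segment_compact.
    exact: continuous_subspaceT.
  rewrite /D Rintegral_itv_bndo_bndc; last first.
    by apply: intf => //; exact: subset_itv_oo_cc.
  by rewrite Rintegral_itv_obnd_cbnd//; apply: intf => //; exact: subset_itv_oc_cc.
have phia : phi a = 0.
  by apply: test_function_eq0 tphi _; rewrite /D/= in_itv/= ltxx.
have phib : phi b = 0.
  by apply: test_function_eq0 tphi _; rewrite /D/= in_itv/= ltxx andbF.
rewrite !toitv; last 2 first.
- by move=> x; apply: continuousM; [exact: cphi'|exact: cpsi].
- by move=> x; apply: continuousM; [exact: cphi|exact: cpsi'].
rewrite (Rintegration_by_parts (f := phi^`()%classic) (G := psi) ab)//.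
- by rewrite phia phib !mul0r subr0 sub0r.
- exact: continuous_subspaceT.
- by apply: derivable_oo_LRcontinuousT => t; exact: test_function_derivable.
- exact: continuous_subspaceT.
- by apply: derivable_oo_LRcontinuousT => t; exact: test_function_derivable.
Qed.

End test_function_theory.

(** * The one-sided Poincare inequality *)

Section half_poincare.
Variables (R : realType) (a b p : R).
Hypotheses (ab : a < b) (p1 : 1 < p).
Local Notation mu := (@lebesgue_measure R).
Let D : set R := `]a, b[.
Let p0 : 0 < p. Proof. exact: lt_trans p1. Qed.
Let mD : measurable D. Proof. exact: measurable_itv. Qed.
Let ba0 : 0 < b - a. Proof. by rewrite subr_gt0. Qed.

Let measurable_cont (f : R -> R) : continuous f -> measurable_fun D f.
Proof.
by move=> cf; apply: measurable_funTS; exact: continuous_measurable_fun.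
Qed.

Let measurable_maxr0 (f : R -> R) : measurable_fun D f ->
  measurable_fun D (fun x => Num.max (f x) 0).
Proof. by move=> mf; apply: measurable_maxr. Qed.

Lemma Lp_measurable (f : R -> R) : Lp D p f -> measurable_fun D f.
Proof.
move=> /sub_Lfun_mfun; rewrite inE => mf.
apply/(measurable_restrictT _ mD); exact: mf.
Qed.

(** Hoelder bounds the supremum of |phi| at the cost of (b - a)^(1 - 1/p); passing from the supremum
    to the L^p norm costs (b - a)^(1/p). The exponents add up to 1. *)
Lemma test_function_poincare (phi : R -> R) : test_function D phi ->
  (Lp_norm D p phi <=
   (b - a)%:E * Lp_norm D p (fun t => Num.max (phi^`()%classic t) 0)%R)%E.
Proof.
move=> tphi; set g := fun t => _; set N := Lp_norm D p g.
have mphi : measurable_fun D phi.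
  exact: measurable_cont (test_function_continuous tphi).
have mg : measurable_fun D g.
  apply: measurable_maxr0; apply: measurable_cont.
  exact: test_function_derive_continuous tphi.
have N0 : (0 <= N)%E by exact: Lp_norm_ge0.
have [->|Noo] := eqVneq N +oo%E; first by rewrite gt0_muley ?lte_fin// leey.
have Nfin : N \is a fin_num by rewrite ge0_fin_numE// ltey.
pose r := fine N * (b - a) `^ (1 - p^-1).
have phir x : D x -> `|phi x| <= r.
  move=> Dx; rewrite -lee_fin.
  apply: (le_trans (test_function_le_integral tphi Dx)).
  have := integral_le_Lp_norm ab p1 mg; rewrite -/N -(fineK Nfin) -EFinM.
  apply: le_trans; rewrite le_eqVlt; apply/orP; left; apply/eqP.
  apply: eq_integral => t _; rewrite ger0_norm//.
  by rewrite le_max lexx orbT.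
apply: (le_trans (Lp_norm_le_cst ab p1 mphi phir)).
rewrite -(fineK Nfin) -!EFinM lee_fin /r -mulrA -powRD; last first.
  by rewrite (gt_eqF ba0) implybT.
by rewrite subrK powRr1 ?(ltW ba0)// mulrC.
Qed.

(** Both sides are continuous in the W^{1,p} norm, so the inequality passes from test functions to
    their closure. *)
Lemma W01p_poincare (c : R) (u v : R -> R) : W01p D p (u, v) ->
  (Lp_norm D p (fun x => c * u x)%R <=
   (b - a)%:E * Lp_norm D p (fun t => Num.max (c * v t) 0)%R)%E.
Proof.
move=> [[/= Lu Lv _] dense]; set N := Lp_norm D p (fun t => Num.max _ _).
have mu' := Lp_measurable Lu; have mv := Lp_measurable Lv.
apply/lee_addgt0Pr => e e0.
(* With d = e / K, replacing [u] costs |c| d and replacing [v] costs (b - a) |c| d, together (K - 1)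
   d <= e. The final 1 keeps [K] positive when [c] is 0. *)
pose K := `|c| * (1 + (b - a)) + 1.
have K0 : 0 < K by rewrite ltr_wpDl// mulr_ge0// addr_ge0// ltW.
have [phi tphi] := dense (e / K) (divr_gt0 e0 K0).
have d0 : 0 < e / K by exact: divr_gt0.
set d := e / K in d0 *; rewrite /W1p_norm/= => close.
have mphi : measurable_fun D phi.
  exact: measurable_cont (test_function_continuous tphi).
have mphi' : measurable_fun D (phi^`()%classic).
  exact: measurable_cont (test_function_derive_continuous tphi).
have close1 : (Lp_norm D p (u \- phi)%R <= d%:E)%E.
  by apply: le_trans (ltW close); rewrite leeDl// Lp_norm_ge0.
have close2 : (Lp_norm D p (v \- phi^`()%classic)%R <= d%:E)%E.
  by apply: le_trans (ltW close); rewrite leeDr// Lp_norm_ge0.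
have mcu : measurable_fun D (u \- phi) by exact: measurable_funB.
have mcv : measurable_fun D (v \- phi^`()%classic) by exact: measurable_funB.
have mZ (f : R -> R) : measurable_fun D f -> measurable_fun D (fun x => c * f x).
  by move=> mf; exact: measurable_funM.
have step1 : (Lp_norm D p (fun x => c * u x)%R <=
    Lp_norm D p (fun x => c * phi x)%R + (`|c| * d)%:E)%E.
  have -> : (fun x => c * u x) =
      ((fun x => c * phi x) \+ (fun x => c * (u \- phi) x)).
    by apply/funext => x /=; rewrite -mulrDr addrC subrK.
  apply: (le_trans (Lp_normD p1 (mZ _ mphi) (mZ _ mcu))).
  by rewrite leeD2l// Lp_normZ// EFinM lee_wpmul2l.
have step2 : (Lp_norm D p (fun t => Num.max (c * phi^`()%classic t) 0)%R <=
    N + (`|c| * d)%:E)%E.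
  (* The positive part is 1-Lipschitz, so [h] dominates the change caused by replacing [v] with the
     derivative of [phi]. *)
  pose h x := `|c * (v \- phi^`()%classic) x|.
  have mh : measurable_fun D h by apply: measurableT_comp => //; exact: mZ.
  have mN := measurable_maxr0 (mZ _ mv).
  apply: (@le_trans _ _ (N + Lp_norm D p h)%E).
    apply: le_trans (Lp_normD p1 mN mh).
    apply: le_Lp_norm => //.
    - exact: measurable_maxr0 (mZ _ mphi').
    - exact: measurable_funD.
    - move=> x _ /=.
      have max0 y : 0 <= Num.max y (0 : R) by rewrite le_max lexx orbT.
      have sum0 : 0 <= Num.max (c * v x) 0 + h x by rewrite addr_ge0// normr_ge0.
      rewrite (ger0_norm (max0 _)) (ger0_norm sum0) ge_max sum0 andbT /h /=.
      have : c * v x <= Num.max (c * v x) 0 by rewrite le_max lexx.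
      have := ler_norm (- (c * (v x - phi^`()%classic x))).
      rewrite normrN; lra.
  rewrite leeD2l//.
  apply: (@le_trans _ _
    (Lp_norm D p (fun x => c * (v \- phi^`()%classic) x))).
    by apply: le_Lp_norm => // [|x _]; [exact: mZ|rewrite normr_id].
  by rewrite Lp_normZ// EFinM lee_wpmul2l.
apply: (le_trans step1).
have := test_function_poincare (test_functionZ c tphi).
rewrite (test_functionZ_derive c tphi) => poinc.
apply: (@le_trans _ _ ((b - a)%:E * (N + (`|c| * d)%:E) + (`|c| * d)%:E)%E).
  rewrite leeD2r//; apply: (le_trans poinc); rewrite lee_wpmul2l// lee_fin.
  exact: ltW.
have cd0 : 0 <= `|c| * d := mulr_ge0 (normr_ge0 _) (ltW d0).
rewrite ge0_muleDr ?Lp_norm_ge0 ?lee_fin//.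
rewrite -addeA leeD2l// -EFinM -EFinD lee_fin.
have -> : (b - a) * (`|c| * d) + `|c| * d = (K - 1) * d.
  by rewrite /K; ring.
have : e = K * d by rewrite /d mulrC divfK ?gt_eqF.
by move=> ->; rewrite ler_wpM2r ?(ltW d0)// gerBl.
Qed.

End half_poincare.

(** * Positively homogeneous functions on the line *)

Section positivity.
Variables (R : realType) (H : R -> R).
Hypothesis scrHH : scrH H.

(** Homogeneity with factor 2 gives H 0 = 2 H 0. *)
Let H0 : H 0 = 0.
Proof.
have [_ _ /(_ 2 0)] := scrHH; rewrite mulr0 => /(_ ltac:(by [])) h; lra.
Qed.

(** Homogeneity determines [H] on each half-line from its value at 1 or -1. This form yields both
    measurability and the linear minorant. *)
Let HE x : H x = H 1 * Num.max x 0 + H (-1) * Num.max (- x) 0.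
Proof.
have [_ _ HZ] := scrHH; have [x0|x0|->] := ltrgtP x 0.
- have -> : Num.max (- x) 0 = - x by apply: max_l; rewrite oppr_ge0 ltW.
  by rewrite mulr0 add0r [RHS]mulrC -HZ ?oppr_gt0// mulrN1 opprK.
- have -> : Num.max (- x) 0 = 0 by apply: max_r; rewrite oppr_le0 ltW.
  by rewrite mulr0 addr0 [RHS]mulrC -HZ// mulr1.
- by rewrite oppr0 maxxx !mulr0 addr0 H0.
Qed.

Lemma scrH_measurable (D : set R) (f : R -> R) : measurable_fun D f ->
  measurable_fun D (H \o f).
Proof.
move=> mf.
rewrite (_ : H = fun x => H 1 * Num.max x 0 + H (-1) * Num.max (- x) 0).
  apply: measurable_funD; apply: measurable_funM => //;
    apply: measurable_maxr => //.
  exact: measurableT_comp.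
by apply/funext => x; exact: HE.
Qed.

(** Both terms of [HE] are non-negative, so either one may be dropped; the one kept must have a
    nonzero coefficient, and the two coefficients vanish together only if [H] is 0. *)
Lemma scrH_ge_linear : H <> (fun=> 0) ->
  exists2 c : R, c != 0 & forall x, Num.max (c * x) 0 <= H x.
Proof.
have [Hge0 _ _] := scrHH; move=> Hneq0.
have ge_max0 (x : R) : 0 <= Num.max x 0 by rewrite le_max lexx orbT.
have [h1|h1] := eqVneq (H 1) 0; last first.
  exists (H 1) => // x; rewrite ge_max Hge0 andbT (HE x).
  rewrite -[leLHS]addr0 lerD ?mulr_ge0 ?ler_wpM2l//.
  by rewrite le_max lexx.
have [h2|h2] := eqVneq (H (-1)) 0.
  by exfalso; apply: Hneq0; apply/funext => x; rewrite HE h1 h2 !mul0r addr0.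
exists (- H (-1)); first by rewrite oppr_eq0.
move=> x; rewrite ge_max Hge0 andbT (HE x).
rewrite -[leLHS]add0r lerD ?mulr_ge0//.
by rewrite mulNr -mulrN ler_wpM2l// le_max lexx.
Qed.

End positivity.

(** * The lower bound on the level *)

Lemma lambda_gt0 (R : realType) (p T : R) (H : R -> R) :
  1 < p -> 0 < T -> scrH H -> H <> (fun=> 0) -> (0 < lambda H p T)%E.
Proof.
move=> p1 T0 scrHH /(scrH_ge_linear scrHH)[c c0 cH].
have p0 : 0 < p by exact: lt_trans p1.
have TT : - T < T by rewrite gtrN.
(* [k] is the Poincare bound for a normalized [u] on an interval of length 2 T; its power [p] bounds
   every admissible energy from below. *)
pose k := `|c| / (T - - T).
have k0 : 0 < k by rewrite divr_gt0 ?normr_gt0// subr_gt0.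
apply: (@lt_le_trans _ _ (k `^ p)%:E); first by rewrite lte_fin powR_gt0.
apply: le_ereal_inf_tmp => _ [u [v [W u1 ->]]].
set D := `]- T, T[%classic in W u1 *.
have [[/= Lu Lv _] _] := W.
have mu' := Lp_measurable Lu; have mv := Lp_measurable Lv.
have mHv := scrH_measurable scrHH mv.
have Hge0 : forall x, 0 <= H x by have [] := scrHH.
have normu : Lp_norm D p u = 1%E by rewrite Lp_normE// u1 poweR1r.
have := W01p_poincare TT p1 c W.
rewrite Lp_normZ// normu mule1 => poinc.
have kN : (k%:E <= Lp_norm D p (H \o v))%E.
  rewrite /k EFinM muleC lee_pdivrMl ?subr_gt0//.
  apply: (le_trans poinc); rewrite lee_wpmul2l ?lee_fin ?subr_ge0 ?(ltW TT)//.
  apply: le_Lp_norm => //.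
    by apply: measurable_maxr => //; exact: measurable_funM.
  move=> x _ /=; rewrite (ger0_norm (Hge0 _)) ger0_norm ?cH//.
  by rewrite le_max lexx orbT.
rewrite -poweR_EFin; apply: (@le_trans _ _ (Lp_norm D p (H \o v) `^ p)%E).
  apply: gt0_ler_poweR => //; rewrite ?(ltW p0)// in_itv/= ?leey ?andbT.
    by rewrite lee_fin ltW.
  exact: Lp_norm_ge0.
rewrite Lp_norm_powR//.
by under eq_integral do rewrite /= (ger0_norm (Hge0 _)).
Qed.

(** * Functions flat at the origin *)

Section flat_exponential.
Variable R : realType.

(** Differentiating exp(-1/x) produces powers of 1/x; indexing by that power makes the linear span
    of the family stable under differentiation. *)
Definition flat_exp (k : nat) (x : R) : R :=
  if 0 < x then x^-1 ^+ k * expR (- x^-1) else 0.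

Lemma flat_exp_eq0 k x : x <= 0 -> flat_exp k x = 0.
Proof. by rewrite /flat_exp ltNge => ->. Qed.

Lemma flat_exp_ge0 k x : 0 <= flat_exp k x.
Proof.
rewrite /flat_exp; case: ifPn => // x0.
by rewrite mulr_ge0 ?expR_ge0// exprn_ge0// invr_ge0 ltW.
Qed.

(** For y = 1/x > 0 the exponential series gives exp y >= y^(k+2) / (k+2)!. A quadratic bound is
    what makes the derivative at 0 vanish. *)
Lemma flat_exp_le_sqr k x : flat_exp k x <= (k.+2)`!%:R * x ^+ 2.
Proof.
rewrite /flat_exp; case: ifPn => x0; last by rewrite mulr_ge0// sqr_ge0.
have y0 : 0 < x^-1 by rewrite invr_gt0.
have f0 : 0 < (k.+2)`!%:R :> R by rewrite ltr0n fact_gt0.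
have le_exp : x^-1 ^+ k.+2 / (k.+2)`!%:R <= expR (x^-1).
  by apply: le_trans (expR_ge1Dxn k.+1 (ltW y0)); rewrite lerDr.
rewrite expRN ler_pdivrMr ?expR_gt0// -[_ * _ ^+ 2]mulrC.
apply: le_trans (_ : x ^+ 2 * (k.+2)`!%:R *
   (x^-1 ^+ k.+2 / (k.+2)`!%:R) <= _); last first.
  by rewrite ler_wpM2l// mulr_ge0// ?sqr_ge0 ?ltW.
rewrite -mulrA (mulrCA _ (x^-1 ^+ _)) mulfV ?gt_eqF// mulr1.
by rewrite -(addn2 k) exprD mulrCA -exprMn mulfV ?gt_eqF// expr1n mulr1.
Qed.

(** Away from 0 the function agrees locally with an explicit formula or with 0; at 0 the quadratic
    bound controls the difference quotient. *)
Lemma is_derive_flat_exp k (x : R) :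
  is_derive x 1 (flat_exp k) (flat_exp k.+2 x - k%:R * flat_exp k.+1 x).
Proof.
have [x0|x0|<-] := ltrgtP 0 x.
- apply: (@near_eq_is_derive _ _ _ (fun y : R => y^-1 ^+ k * expR (- y^-1))).
    by near=> y; rewrite /flat_exp ifT//; near: y; exact: lt_nbhsr.
  have dV : is_derive x 1 (fun y : R => y^-1) (- x ^- 2).
    apply: is_derive_eq; first by apply: is_deriveV; rewrite gt_eqF.
    by rewrite /GRing.scale/= mulr1.
  have dE : is_derive x 1 (fun y : R => expR (- y^-1)) (expR (- x^-1) * x ^- 2).
    have dN : is_derive x 1 (fun y : R => - y^-1) (x ^- 2).
      by apply: is_derive_eq; rewrite opprK.
    exact: is_derive_eq.
  have dX : is_derive x 1 (fun y : R => y^-1 ^+ k)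
      (k%:R * x^-1 ^+ k.-1 * (- x ^- 2)).
    have -> : (fun y : R => y^-1 ^+ k) = (fun y : R => y^-1) ^+ k.
      by apply/funext => y; rewrite exprfctE.
    exact: is_derive_eq.
  apply: (is_derive_eq (@is_deriveM _ _ (fun y : R => y^-1 ^+ k)
    (fun y : R => expR (- y^-1)) x 1 _ _ dX dE)).
  rewrite /flat_exp x0 /GRing.scale/= -exprVn expr2.
  (* The power rule has the truncated exponent [k.-1]; for k = 0 its coefficient is 0. *)
  by case: k {dX} => [|k]; rewrite ?mul0r ?expr0 //= !exprS; ring.
- apply: (@near_eq_is_derive _ _ _ (fun=> 0 : R)).
    by near=> y; rewrite flat_exp_eq0// ltW//; near: y; exact: lt_nbhsl.
  by rewrite !flat_exp_eq0 ?ltW// mulr0 subr0; exact: is_derive_cst.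
- rewrite !flat_exp_eq0// mulr0 subr0.
  have lim0 :
      (fun h : R => h^-1 *: (flat_exp k (h *: 1 + 0) - flat_exp k 0)) @ 0^'
      --> 0.
    apply/cvgr0Pnorm_le => e e0.
    have C0 : 0 < (k.+2)`!%:R :> R by rewrite ltr0n fact_gt0.
    near=> h.
    have h0 : h != 0 by near: h; exact: nbhs_dnbhs_neq.
    (* This radius turns the bound (k+2)! h^2 into e |h|. *)
    have he : `|h| <= e / (k.+2)`!%:R.
      near: h; apply: dnbhs0_le; exact: divr_gt0.
    rewrite (flat_exp_eq0 _ (lexx 0)) subr0 addr0 /GRing.scale/= mulr1.
    rewrite normrM normfV.
    rewrite ler_pdivrMl ?normr_gt0// (ger0_norm (flat_exp_ge0 _ _)).
    apply: le_trans (flat_exp_le_sqr _ _) _.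
    rewrite -(real_normK (num_real h)) mulrC expr2 -mulrA ler_wpM2l//.
    by rewrite -ler_pdivlMr.
  split; first by apply/cvg_ex; exists 0.
  exact/cvg_lim.
Unshelve. all: by end_near. Qed.

End flat_exponential.

(** * Smoothness and a bump function *)

Section smooth.
Variable R : realType.

(* A class of functions that is closed under differentiation and contains the
   product of [flat_exp 0 (a + x)] and [flat_exp 0 (a - x)]. *)
Inductive flat_algebra : (R -> R) -> Prop :=
| flat_algebra_cst c : flat_algebra (cst c)
| flat_algebra_flat_exp k a b : flat_algebra (fun x => flat_exp k (a + b * x))
| flat_algebraD f g : flat_algebra f -> flat_algebra g -> flat_algebra (f + g)
| flat_algebraM f g : flat_algebra f -> flat_algebra g -> flat_algebra (f * g).

(** Induction on the construction: the chain rule handles the generators, the sum and product rules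
    the rest. Iterating it gives derivatives of all orders. *)
Lemma flat_algebra_is_derive f : flat_algebra f ->
  exists2 g, flat_algebra g & forall x : R, is_derive x 1 f (g x).
Proof.
elim=> [c|k a b|{}f g Af [f' Af' ff'] Ag [g' Ag' gg']|
        {}f g Af [f' Af' ff'] Ag [g' Ag' gg']].
- exists (cst 0); first exact: flat_algebra_cst.
  by move=> x; exact: is_derive_cst.
- pose h (j : nat) x := flat_exp j (a + b * x) : R.
  exists ((h k.+2 + cst (- k%:R) * h k.+1) * cst b).
    do ![apply: flat_algebraM|apply: flat_algebraD]; by constructor.
  move=> x; rewrite /cst /h !fctE mulNr.
  apply: (@is_derive1_comp _ (flat_exp k) (fun y => a + b * y)).
    exact: is_derive_flat_exp.
  apply: is_derive_eq.
  by rewrite /GRing.scale/= add0r mul1r mulr1.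
- exists (f' + g'); first exact: flat_algebraD.
  by move=> x; exact: is_deriveD.
- exists (f * g' + g * f').
    by apply: flat_algebraD; exact: flat_algebraM.
  by move=> x; exact: is_deriveM.
Qed.

Lemma derivable_flat_algebra f n x : flat_algebra f ->
  derivable (f^`(n)%classic) x 1.
Proof.
move=> Af; have {Af} : flat_algebra (f^`(n)%classic).
  elim: n => [|n /flat_algebra_is_derive[g Ag fg]]; first by rewrite derive1n0.
  rewrite derive1nS (_ : (_^`())%classic = g)//.
  by apply/funext => y; rewrite derive1E; exact/derive_val.
by move=> /flat_algebra_is_derive[g _ fg]; exact: (@ex_derive _ _ _ _ _ _ _ (fg x)).
Qed.

End smooth.

Lemma exists_bump (R : realType) (T : R) : 0 < T ->
  exists2 phi : R -> R, test_function `]- T, T[ phi & 0 < phi 0.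
Proof.
(* Any [a] strictly between 0 and [T] leaves room for the closed support [-a, a] inside the open
   interval. *)
move=> T0; pose a := T / 2; have a0 : 0 < a by rewrite divr_gt0.
(* The first factor vanishes for x <= -a, the second for x >= a. The coefficients 1 and -1 are
   written out to match the generators of [flat_algebra]. *)
pose phi (x : R) := flat_exp 0 (a + 1 * x) * flat_exp 0 (a + (-1) * x).
have supp : closure [set x | phi x != 0] `<=` `[- a, a].
  have /closure_id -> : closed `[- a, a]%classic by exact: interval_closed.
  apply: closure_subset => x /= phix; rewrite in_itv/= -!ler_norml leNgt.
  apply/negP => ax; move/negP: phix; apply; rewrite /phi.
  rewrite mulf_eq0; have [x0|x0] := leP 0 x.
    rewrite (flat_exp_eq0 0 (_ : a + -1 * x <= 0)) ?eqxx ?orbT//.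
    by move: ax; rewrite ger0_norm// mulN1r subr_le0 => /ltW.
  rewrite (flat_exp_eq0 0 (_ : a + 1 * x <= 0)) ?eqxx//.
  move: ax; rewrite ltr0_norm// mul1r => /ltW; lra.
exists phi; first split.
- move=> n x; apply: derivable_flat_algebra.
  apply: (@flat_algebraM _ (fun x => flat_exp 0 (a + 1 * x))
            (fun x => flat_exp 0 (a + (-1) * x))); exact: flat_algebra_flat_exp.
- apply: subclosed_compact supp; first exact: closed_closure.
  exact: segment_compact.
- apply: subset_trans supp _ => x /=; rewrite !in_itv/= /a => /andP[]; lra.
- rewrite /phi !mulr0 !addr0 /flat_exp a0 !expr0 !mul1r.
  by rewrite mulr_gt0// expR_gt0.
Qed.

(** * Existence of admissible functions *)

Section admissible.
Variables (R : realType) (a b p : R).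
Hypotheses (ab : a < b) (p1 : 1 < p).
Local Notation mu := (@lebesgue_measure R).
Let D : set R := `]a, b[.
Let p0 : 0 < p. Proof. exact: lt_trans p1. Qed.
Let mD : measurable D. Proof. exact: measurable_itv. Qed.

(** By the extreme value theorem [f] is bounded on [a, b], and [D] has finite measure. *)
Lemma continuous_Lp (f : R -> R) : continuous f -> Lp D p f.
Proof.
move=> cf; have mf : measurable_fun D f.
  by apply: measurable_funTS; exact: continuous_measurable_fun.
have [c _ fc] : exists2 c, c \in `[a, b] &
    forall t, t \in `[a, b] -> `|f t| <= `|f c|.
  apply: (@EVT_max _ (fun t => `|f t|)); first exact: ltW.
  apply: continuous_subspaceT => t.
  by apply: continuous_comp; [exact: cf|exact: norm_continuous].
apply/andP; split; rewrite inE/=.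
  exact/(measurable_restrictT _ mD).
rewrite /finite_norm.
have := Lp_norm_le_cst ab p1 mf (M := `|f c|).
rewrite -EFinM => /(_ _)/le_lt_trans; apply; last exact: ltry.
by move=> x Dx; apply: fc; exact: subset_itv_oo_cc.
Qed.

Lemma W01p_test_function (phi : R -> R) : test_function D phi ->
  W01p D p (phi, phi^`()%classic).
Proof.
move=> tphi; split; [split|].
- exact/continuous_Lp/(test_function_continuous tphi).
- exact/continuous_Lp/(test_function_derive_continuous tphi).
- exact: weak_derivative_test_function.
- move=> e e0; exists phi => //=; rewrite /W1p_norm/=.
  have Lp0 (f : R -> R) : Lp_norm D p (f \- f)%R = 0%E.
    rewrite Lp_normE//.
    under eq_integral do rewrite /= subrr normr0 powR0 ?gt_eqF//.
    by rewrite integral0 poweR0r// invr_neq0// gt_eqF.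
  by rewrite !Lp0 adde0 lte_fin.
Qed.

(** By continuity |f| exceeds |f x| / 2 on a ball inside [D], which has positive measure. *)
Lemma Lp_norm_gt0 (f : R -> R) (x : R) : continuous f -> D x -> f x != 0 ->
  (0 < Lp_norm D p f)%E.
Proof.
move=> cf Dx fx; have mf : measurable_fun D f.
  by apply: measurable_funTS; exact: continuous_measurable_fun.
pose h := `|f x| / 2.
have h0 : 0 < h by rewrite divr_gt0// normr_gt0.
have : \forall y \near x, D y /\ h < `|f y|.
  near=> y; split.
    near: y; exact: near_in_itvoo.
  near: y; have cnf : {for x, continuous (fun y => `|f y|)}.
    by apply: continuous_comp; [exact: cf|exact: norm_continuous].
  apply: (cvgr_gt _ cnf); rewrite /h.
  have : 0 < `|f x| by rewrite normr_gt0.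
  lra.
move=> /nbhs_ballP[r /= r0 xr].
have BD : ball x r `<=` D by move=> y /xr[].
have mB : measurable (ball x r) by exact: measurable_ball.
rewrite Lp_normE//; apply: poweR_gt0.
apply: (@lt_le_trans _ _ (\int[mu]_(y in ball x r) (h `^ p)%:E)%E).
  rewrite integral_cst// [X in (_ * X)%E]lebesgue_measure_ball ?(ltW r0)// -EFinM lte_fin.
  by rewrite mulr_gt0 ?powR_gt0// mulrn_wgt0.
apply: (@le_trans _ _ (\int[mu]_(y in ball x r) (`|f y| `^ p)%:E)%E).
  apply: ge0_le_integral => //.
  - by move=> y _; rewrite lee_fin powR_ge0.
  - by apply: (measurable_funS mD BD); exact: measurable_fun_normr_powR.
  - move=> y /xr[_ hy].
    rewrite lee_fin ge0_ler_powR ?nnegrE ?(ltW p0) ?(ltW h0)//.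
    exact: ltW.
apply: ge0_subset_integral => //.
exact: measurable_fun_normr_powR.
Unshelve. all: by end_near. Qed.

End admissible.

Lemma exists_admissible (R : realType) (p T : R) : 1 < p -> 0 < T ->
  exists u v : R -> R, W01p `]- T, T[ p (u, v) /\
    (\int[@lebesgue_measure R]_(t in `](- T)%R, T[%classic) (`|u t| `^ p)%:E = 1)%E.
Proof.
move=> p1 T0; have TT : - T < T by rewrite gtrN.
have [phi tphi phi0] := exists_bump T0.
set D := `]- T, T[%classic in tphi *.
have cphi := test_function_continuous tphi.
have D0 : D 0 by rewrite /D/= in_itv/= oppr_lt0 T0.
have N0 : (0 < Lp_norm D p phi)%E.
  by apply: (Lp_norm_gt0 p1 cphi D0); rewrite gt_eqF.
have Lphi : Lp D p phi by exact: continuous_Lp.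
have Nfin : Lp_norm D p phi \is a fin_num.
  by rewrite gt0_fin_numE//; move: Lphi => /sub_Lfun_finLfun; rewrite inE.
(* The norm of the bump is positive and finite, so dividing by it gives norm 1. *)
pose c := (fine (Lp_norm D p phi))^-1.
exists (fun x => c * phi x), (fun x => c * phi x)^`()%classic; split.
  exact: W01p_test_function (test_functionZ c tphi).
rewrite -Lp_norm_powR// Lp_normZ//; last exact: Lp_measurable Lphi.
have F0 : 0 < fine (Lp_norm D p phi) by rewrite fine_gt0// N0 ltey_eq Nfin.
rewrite -(fineK Nfin) -EFinM ger0_norm ?invr_ge0 ?(ltW F0)//.
by rewrite /c mulVf ?gt_eqF// poweR_EFin powR1.
Qed.

Theorem corollary1p1 (R : realType) (p T : R) (H : R -> R) :
  1 < p -> 0 < T -> scrH H ->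
  ((0 < lambda H p T)%E <-> H <> (fun=> 0)).
Proof.
move=> p1 T0 scrHH; split=> [lambda0 H0|]; last exact: lambda_gt0.
have [u [v [W u1]]] := exists_admissible p1 T0.
move: lambda0; apply/negP; rewrite -leNgt.
apply: ge_ereal_inf; exists 0%E => //; exists u, v; split=> //.
(* Since [p] is nonzero, 0 to the power [p] is 0, and the admissible pair has energy 0; the power 0
   of 0 would be 1. *)
rewrite H0; under eq_integral do rewrite powR0 ?gt_eqF ?(lt_trans ltr01 p1)//.
by rewrite integral0.
Qed.
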